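(* In the setting of the context (a weighted genus two admissible cover over the standard log point, with associated function $\lambda$ and degree one effective divisor $D$ on $\Delta_T$), if $D=\tfrac12(D_1+D_2)$ for two distinct points $D_1,D_2$ of $\Delta_T$, then $\lambda(D_1)=\lambda(D_2)=0$ (i.e. $\lambda_T(D_1)=\lambda_T(D_2)=0$, equivalently $\lambda$ vanishes on the preimages of $D_1$ and $D_2$).
   Context: *Admissible cover.* Over $\mathbb C$, let $\psi\colon(C,D_R)\to(T,D_B)$ be a hyperelliptic admissible cover: a finite degree two morphism of nodal curves, $C$ connected of arithmetic genus $2$, $T$ of genus $0$, étale on $C^{sm}\setminus D_R$, simply ramified along the six smooth points $D_R$ mapping to six distinct smooth points $D_B$, mapping nodes to nodes with the same ramification order $1$ or $2$ on both branches. It carries a weight $w\colon V(\Gamma)\to\mathbb N$ on the dual graph of $C$, not identically zero, such that with $w_T(v)=\sum_{v'\mapsto v}w(v')$ every component of $T$ with $w_T=0$ has at least three nodes or branch points. *Metric.* $\Gamma=\mathrm{trop}(C)$ and the tree $\Gamma_T=\mathrm{trop}(T)$ are the dual graphs with positive real edge lengths, where the length of an edge of $\Gamma_T$ is the ramification order (expansion factor) times the length of any edge of $\Gamma$ above it; $\mathrm{trop}(\psi)\colon\Gamma\to\Gamma_T$ is the induced harmonic map of degree two. For a subcurve, genus means arithmetic genus: first Betti number plus sum of vertex genera. *Functions.* A piecewise linear (PL) function has integral slopes on (a subdivision of) $\Gamma$ (half-integral slopes allowed on $\Gamma_T$); $\mathrm{div}(\lambda)(v)$ is the sum of outgoing slopes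 at $v$; $K_\Gamma(v)=2g(v)-2+\mathrm{val}(v)$. Pullback along $\mathrm{trop}(\psi)$ composes functions and multiplies divisors by local degrees. On $\Gamma_T$ let $D'(v)=\mathrm{val}(v)-2+\tfrac12\deg(D_B|_v)$ (valence counts edges only); it has degree $1$ and pulls back to $K_\Gamma$. For each vertex $v_0$ of $\Gamma_T$ there is a PL function $\overline\lambda_T$, unique up to constants, with $D'+\mathrm{div}(\overline\lambda_T)=v_0$; its pullback to $\Gamma$ is an *admissible function*. Let $\overline\lambda_1,\dots,\overline\lambda_s$ be all of them and let $\lambda_i$ be $\overline\lambda_i$ shifted by a constant so that vertices with $\lambda_i>0$ have weight $0$ while those with $\lambda_i\ge0$ have total weight $\ge1$ (i.e. the maximum of $\lambda_i$ on vertices of positive weight is $0$). Define $\lambda=\max\{0,\lambda_1,\dots,\lambda_s\}$, a PL function on a subdivision of $\Gamma$, pulled back from $\lambda_T$ on $\Gamma_T$. Put $\Delta^\circ=\{\lambda>0\}$ and let $\Delta$ be the minimal subcurve of genus two containing the closure of $\Delta^\circ$, $\Delta_T$ its image in $\Gamma_T$. With $D'$ computed using valences in $\Delta_T$, $D=D'+\mathrm{div}(\lambda_T)$ is an effective divisor of degree $1$ with half-integral coefficients on $\Delta_T$ (a point, or half the sum of two points in the locus of expansion factor $2$) and $\mathrm{trop}(\psi)^*D=K_\Delta+\mathrm{div}(\lambda)$ on $\Delta$. *)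

(* Defs.v *)
From HB Require Import structures.
From mathcomp Require Import all_boot all_order all_algebra.
From mathcomp Require Import all_classical all_reals all_analysis.

Set Implicit Arguments.
Unset Strict Implicit.
Unset Printing Implicit Defensive.

Import Order.TTheory GRing.Theory Num.Theory.
Import numFieldNormedType.Exports.

Local Open Scope ring_scope.
Local Open Scope classical_set_scope.

(* Nodal curves are represented by their dual graphs: a weighted hyperelliptic
   admissible cover C -> T with lengths of nodes is recorded by the map of dual
   graphs, local degrees, expansion factors and the components carrying the
   ramification points.  Every datum satisfying [admissible_cover] comes from an
   actual cover: over C, a double cover of P^1 exists with any prescribed
   nonempty branch divisor of even degree. *)

(* The orientation [src], [tgt] only serves to parametrise edges. *)
Record graph := Graph {
  vert : finType;
  edge : finType;
  src : edge -> vert;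
  tgt : edge -> vert }.

(* A half-edge is an edge with one of its ends: [(e, false)] starts at [src e],
   [(e, true)] starts at [tgt e].  A loop contributes two half-edges. *)
Definition hend (G : graph) (h : edge G * bool) : vert G :=
  if h.2 then tgt h.1 else src h.1.

(* Subcurves are unions of irreducible components, hence correspond to full
   (induced) subgraphs, given by their set of vertices. *)
Section Subcurves.
Variable G : graph.
Implicit Types S : {set vert G}.

Definition full_edges S : {set edge G} :=
  [set e | (src e \in S) && (tgt e \in S)].

Definition adj S : rel (vert G) := fun u v =>
  [exists e in full_edges S,
     ((src e == u) && (tgt e == v)) || ((src e == v) && (tgt e == u))].

Definition nb_components S : nat := n_comp (adj S) (mem S).

Definition connected_subcurve S : Prop := nb_components S = 1%N.

(* First Betti number E + c - V; the natural subtraction never truncates. *)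
Definition betti1 S : nat := (#|full_edges S| + nb_components S - #|S|)%N.

Definition arith_genus (g : vert G -> nat) S : nat :=
  (betti1 S + \sum_(v in S) g v)%N.

End Subcurves.

Record mgraph (R : realType) := MGraph {
  mgraph_graph :> graph;
  len : edge mgraph_graph -> R;
  len_gt0 : forall e, 0 < len e }.

Section Points.
Variables (R : realType) (G : mgraph R).

(* [inr (e, x)] is the point in the interior of [e] at distance [x] from
   [src e]. *)
Definition valid_point (q : vert G + edge G * R) : bool :=
  match q with inl _ => true | inr (e, x) => 0 < x < len e end.

Definition gpoint := {q : vert G + edge G * R | valid_point q}.

Definition vpt (v : vert G) : gpoint := exist _ (inl v) isT.

(* The point of the closed edge [e] at distance [x] from [src e]; clipped to
   the ends of [e] when [x] is not in [[0, len e]]. *)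
Definition edge_pt (e : edge G) (x : R) : gpoint :=
  if x <= 0 then vpt (src e) else insubd (vpt (tgt e)) (inr (e, x)).

(* The tangent directions at a vertex are the half-edges starting there; those
   at an interior point of [e] are [(e, false)], towards [tgt e], and
   [(e, true)], towards [src e]. *)
Definition direction_at (p : gpoint) (h : edge G * bool) : bool :=
  match val p with inl v => hend h == v | inr (e, _) => h.1 == e end.

(* The point at distance [t] from [p] in direction [h], meaningful when
   [direction_at p h] and [t] is at most the distance to the end of [h.1]. *)
Definition step (p : gpoint) (h : edge G * bool) (t : R) : gpoint :=
  let x := match val p with
           | inl _ => if h.2 then len h.1 else 0
           | inr (_, y) => y
           end in
  edge_pt h.1 (if h.2 then x - t else x + t).

(* The direction [h] at [p] stays in [A] for a short while. *)
Definition tangent (A : set gpoint) (p : gpoint) (h : edge G * bool) : bool :=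
  direction_at p h && `[< \forall t \near (0 : R)^'+, A (step p h t) >].

Definition valence (A : set gpoint) (p : gpoint) : nat :=
  #|[set h : edge G * bool | tangent A p h]%SET|.

Definition outslope (f : gpoint -> R) (p : gpoint) (h : edge G * bool) : R :=
  lim ((f (step p h t) - f p) / t @[t --> (0 : R)^'+]).

Definition pl_div (A : set gpoint) (f : gpoint -> R) (p : gpoint) : R :=
  \sum_(h : edge G * bool | tangent A p h) outslope f p h.

Definition graph_closure (A : set gpoint) : set gpoint :=
  [set p | A p \/ exists2 h : edge G * bool, direction_at p h &
     forall eps : R, 0 < eps -> exists2 t, 0 < t < eps & A (step p h t)].

Definition subdivision (c : edge G -> seq R) : Prop :=
  forall e, path (fun x y : R => x < y) 0 (rcons (c e) (len e)).

Definition knot (c : edge G -> seq R) (e : edge G) (i : nat) : R :=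
  nth 0 (0 :: rcons (c e) (len e)) i.

(* Slopes in (1/k)Z; including the end points of the segments makes [f]
   continuous. *)
Definition is_PL (k : nat) (f : gpoint -> R) : Prop :=
  exists2 c, subdivision c &
    forall (e : edge G) (i : 'I_(size (c e)).+1), exists a : int,
      forall x, knot c e i <= x <= knot c e i.+1 ->
        f (edge_pt e x) =
        f (edge_pt e (knot c e i)) + a%:~R / k%:R * (x - knot c e i).

Section Subdivide.
Variable c : edge G -> seq R.

Let sd_vert : finType := (vert G + {e : edge G & 'I_(size (c e))})%type.
Let sd_edge : finType := {e : edge G & 'I_(size (c e)).+1}.

(* The [i]-th segment of [e] runs from [knot c e i] to [knot c e i.+1]. *)
Definition sd_src (s : sd_edge) : sd_vert :=
  let: existT e i := s in
  if unlift ord0 i is Some j then inr (existT _ e j) else inl (src e).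

Definition sd_tgt (s : sd_edge) : sd_vert :=
  let: existT e i := s in
  if unlift ord_max i is Some j then inr (existT _ e j) else inl (tgt e).

Definition subdivide : graph := @Graph sd_vert sd_edge sd_src sd_tgt.

Definition sd_point (v : vert subdivide) : gpoint :=
  match v with
  | inl v0 => vpt v0
  | inr (existT e j) => edge_pt e (nth 0 (c e) j)
  end.

Definition sd_genus (g : vert G -> nat) (v : vert subdivide) : nat :=
  match v with inl v0 => g v0 | inr _ => 0%N end.

Definition open_segment (s : edge subdivide) : set gpoint :=
  let: existT e i := s in
  [set p | exists2 x, knot c e i < x < knot c e i.+1 & p = edge_pt e x].

Definition sd_realization (S : {set vert subdivide}) : set gpoint :=
  [set p | (exists2 v, v \in S & p = sd_point v) \/
           (exists2 s, s \in full_edges S & open_segment s p)].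

End Subdivide.

Definition genus_two_subcurve (g : vert G -> nat) (A : set gpoint) : Prop :=
  exists c (S : {set vert (subdivide c)}),
    [/\ subdivision c, connected_subcurve S,
        arith_genus (sd_genus g) S = 2%N & A = sd_realization S].

Definition minimal_genus_two_subcurve (g : vert G -> nat)
    (Z A : set gpoint) : Prop :=
  [/\ genus_two_subcurve g A, Z `<=` A &
      forall B, genus_two_subcurve g B -> Z `<=` B -> B `<=` A -> B = A].

End Points.

(* The graph of C is oriented compatibly with that of T.  The [i]-th point of
   D_R lies on the component [ram i]; the [i]-th point of D_B on its image. *)
Record admissible_cover (R : realType) := AdmissibleCover {
  Gam : mgraph R;
  GamT : mgraph R;
  genus : vert Gam -> nat;
  mapV : vert Gam -> vert GamT;
  mapE : edge Gam -> edge GamT;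
  deg : vert Gam -> nat;
  ramif : edge Gam -> nat;
  ram : 'I_6 -> vert Gam;
  weight : vert Gam -> nat;
  Gam_connected : connected_subcurve [set: vert Gam]%SET;
  Gam_genus : arith_genus genus [set: vert Gam]%SET = 2%N;
  GamT_connected : connected_subcurve [set: vert GamT]%SET;
  GamT_genus : arith_genus (fun _ => 0%N) [set: vert GamT]%SET = 0%N;
  mapE_src : forall e, mapV (src e) = src (mapE e);
  mapE_tgt : forall e, mapV (tgt e) = tgt (mapE e);
  deg_gt0 : forall v, (0 < deg v)%N;
  deg_fiber : forall t, (\sum_(v | mapV v == t) deg v = 2)%N;
  ramif12 : forall e, ramif e = 1%N \/ ramif e = 2%N;
  (* C -> T has degree [deg v] on the component [v], also over the nodes *)
  harmonic : forall v (h' : edge GamT * bool), hend h' = mapV v ->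
        (\sum_(h : edge Gam * bool |
               (hend h == v) && ((mapE h.1, h.2) == h')) ramif h.1)%N = deg v;
  deg_ram : forall i, deg (ram i) = 2%N;
  (* Riemann-Hurwitz on each component: there is no ramification other than
     the simple one along D_R and the prescribed one at the nodes *)
  riemann_hurwitz : forall v, (2 * genus v + 2 * deg v =
        2 + #|[set i | ram i == v]%SET|
          + \sum_(h : edge Gam * bool | hend h == v) (ramif h.1).-1)%N;
  len_mapE : forall e, len (mapE e) = (ramif e)%:R * len e;
  weight_neq0 : exists v, weight v != 0%N;
  weight_stable : forall t, (\sum_(v | mapV v == t) weight v = 0)%N ->
        (3 <= #|[set h : edge GamT * bool | hend h == t]%SET|
              + #|[set i | mapV (ram i) == t]%SET|)%N }.

Arguments genus {R} psi v : rename.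

Section AdmissibleFunctions.
Variables (R : realType) (psi : admissible_cover R).

Definition trop (q : gpoint (Gam psi)) : gpoint (GamT psi) :=
  match val q with
  | inl v => vpt (mapV v)
  | inr (e, x) => edge_pt (mapE e) ((ramif e)%:R * x)
  end.

Definition deg_branch (p : gpoint (GamT psi)) : nat :=
  #|[set i | vpt (mapV (ram psi i)) == p]%SET|.

(* For a subspace [A], the valence at an end point of [A] drops accordingly. *)
Definition Dprime (A : set (gpoint (GamT psi))) (p : gpoint (GamT psi)) : R :=
  (valence A p)%:R - 2 + 2^-1 * (deg_branch p)%:R.

Definition admissible_function (v0 : vert (GamT psi))
    (f : gpoint (GamT psi) -> R) : Prop :=
  is_PL 2 f /\
  forall p, Dprime setT p + pl_div setT f p = (p == vpt v0)%:R.

Definition normalized (f : gpoint (Gam psi) -> R) : Prop :=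
  (forall v, 0 < f (vpt v) -> weight v = 0%N) /\
  (1 <= \sum_(v : vert (Gam psi) | (0 <= f (vpt v))%R) weight v)%N.

(* The functions [lambar v0] on the tree and the constants [c v0] range over
   all vertices [v0] of the tree. *)
Variables (lambar : vert (GamT psi) -> gpoint (GamT psi) -> R)
          (c : vert (GamT psi) -> R).

Definition lami (v0 : vert (GamT psi)) (q : gpoint (Gam psi)) : R :=
  lambar v0 (trop q) + c v0.

Definition lam (q : gpoint (Gam psi)) : R :=
  \big[Num.max/0]_(v0 : vert (GamT psi)) lami v0 q.

Definition lamT (p : gpoint (GamT psi)) : R :=
  \big[Num.max/0]_(v0 : vert (GamT psi)) (lambar v0 p + c v0).

Lemma lamE (q : gpoint (Gam psi)) : lam q = lamT (trop q).
Proof. by []. Qed.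

Definition Ddiv (A : set (gpoint (GamT psi))) (p : gpoint (GamT psi)) : R :=
  Dprime A p + pl_div A lamT p.

End AdmissibleFunctions.

Arguments trop {R} psi q.

(* Main.v *)
(* Suppose lamT p > 0. Near p the function lamT is the maximum of those
   lambar v + c v that are maximal at p, and every direction at p stays in
   Delta_T. The slopes of two admissible functions along an edge differ by an
   integer: doubled and reduced mod 2, the difference is a cycle with F_2
   coefficients on a tree. So D'(p) + div(lamT)(p) agrees, up to an integer, with
   D'(p) + div(lambar v)(p), which is 0 or 1; it cannot be 1/2. *)
Require Import Defs.
From mathcomp Require Import all_boot all_order all_algebra.
From mathcomp Require Import all_classical all_reals all_analysis.
From mathcomp Require Import ring lra.

Set Implicit Arguments.
Unset Strict Implicit.
Unset Printing Implicit Defensive.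

Import Order.TTheory GRing.Theory Num.Theory.
Import numFieldNormedType.Exports.

Local Open Scope ring_scope.
Local Open Scope classical_set_scope.

Lemma sum_halfedges (E : finType) (M : nmodType) (P : pred (E * bool))
    (F : E * bool -> M) :
  \sum_(h | P h) F h =
  \sum_e ((if P (e, false) then F (e, false) else 0) +
          (if P (e, true) then F (e, true) else 0)).
Proof.
rewrite big_mkcond [LHS](eq_bigr (fun h => (fun e b =>
  if P (e, b) then F (e, b) else 0) h.1 h.2)); last by case.
rewrite -(pair_bigA _ (fun e b => if P (e, b) then F (e, b) else 0)) /=.
by apply: eq_bigr => e _; rewrite big_bool addrC.
Qed.

Lemma adj_invariant_const (G : graph) (T : Type) (u : vert G -> T) :
  connected_subcurve [set: vert G]%SET ->
  (forall e : edge G, u (src e) = u (tgt e)) -> forall v w, u v = u w.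
Proof.
move=> conn uE v w; pose r := adj [set: vert G]%SET.
have r_sym : connect_sym r.
  apply: sym_connect_sym => x y; apply/idP/idP => /exists_inP[e eS Pe];
    by apply/exists_inP; exists e => //; rewrite orbC.
have u_conn x y : connect r x y -> u x = u y.
  case/connectP => p; elim: p x => [x _ -> //|z p IHp x /= /andP[xz zp] yE].
  rewrite -(IHp _ zp yE).
  case/exists_inP: xz => e _ /orP[] /andP[/eqP<- /eqP<-]; first exact: uE.
  by rewrite uE.
suff rvw : fingraph.root r v = fingraph.root r w.
  by apply: u_conn; rewrite -(root_connect r_sym) rvw.
have : (n_comp r [set: vert G]%SET <= 1)%N by rewrite [n_comp _ _]conn.
by move/card_le1_eqP; apply; rewrite !inE /= roots_root.
Qed.

(* The coboundary of a connected graph has rank [#|V| - 1], which is [#|E|] on a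
   tree; hence its transpose, the boundary map, is injective. *)
Lemma tree_cycle_eq0 (G : graph) (F : fieldType) (x : edge G -> F) :
  connected_subcurve [set: vert G]%SET ->
  arith_genus (fun _ => 0%N) [set: vert G]%SET = 0%N ->
  (forall v, \sum_(h : edge G * bool | hend h == v)
      (if h.2 then - x h.1 else x h.1) = 0) ->
  forall e, x e = 0.
Proof.
move=> conn gen0 x_cycle.
pose d : 'M[F]_(#|vert G|, #|edge G|) := \matrix_(i, j)
  ((src (enum_val j) == enum_val i)%:R - (tgt (enum_val j) == enum_val i)%:R).
have card_edge : (#|edge G|.+1 <= #|vert G|)%N.
  move: gen0; rewrite /arith_genus big1 ?addn0 // /betti1 conn.
  move/eqP; rewrite subn_eq0 addn1 cardsT; congr (_.+1 <= _)%N.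
  by apply: eq_card => e; rewrite !inE.
have v0 : vert G by exact: enum_val (Ordinal (leq_trans (ltn0Sn _) card_edge)).
have dE v e : d (enum_rank v) (enum_rank e) = (src e == v)%:R - (tgt e == v)%:R.
  by rewrite mxE !enum_rankK.
have rank_bij (T : finType) : {on [pred _ | true], bijective (@enum_rank T)}.
  exact: onW_bij (@enum_rank_bij T).
have sum_delta (a : vert G -> F) v : \sum_w a w * (v == w)%:R = a v.
  rewrite (bigD1 v) //= eqxx mulr1 big1 ?addr0 // => w.
  by rewrite eq_sym => /negbTE->; rewrite mulr0.
have ker_const (k : 'M[F]_#|vert G|) i : k *m d = 0 ->
    forall v w, k i (enum_rank v) = k i (enum_rank w).
  move=> kd; apply: (adj_invariant_const conn) => e.
  move/matrixP/(_ i (enum_rank e)): kd; rewrite !mxE (reindex _ (rank_bij _)) /=.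
  under eq_bigr => v _ do rewrite dE mulrBr.
  by rewrite sumrB !(sum_delta (fun v => k i (enum_rank v))) => /subr0_eq.
have rk_ker : (\rank (kermx d) <= 1)%N.
  move: (kermx d) (mulmx_ker d) => k kd.
  suff -> : k = col (enum_rank v0) k *m const_mx (1 : F).
    by apply: leq_trans (mulmx_max_rank _ _) _.
  apply/matrixP => i j; rewrite !mxE big_ord1 !mxE mulr1.
  by rewrite (ker_const _ i kd v0 (enum_val j)) enum_valK.
have d_full : row_full d.
  rewrite /row_full eqn_leq rank_leq_col /=.
  move: rk_ker; rewrite mxrank_ker leq_subLR addn1 => h.
  by rewrite -ltnS; apply: leq_trans card_edge h.
have /row_fullP[B Bd] := d_full.
pose X : 'cV[F]_#|edge G| := \col_j x (enum_val j).
have dX : d *m X = 0.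
  apply/matrixP => i j; rewrite !mxE -[RHS](x_cycle (enum_val i)) sum_halfedges.
  rewrite (reindex _ (rank_bij _)) /=; apply: eq_bigr => e _.
  rewrite -{1}[i]enum_valK dE mxE enum_rankK /hend /= mulrBl.
  by case: eqP => _; case: eqP => _; rewrite ?mul1r ?mul0r ?oppr0.
move=> e; have : X = 0 by rewrite -[X]mul1mx -Bd -mulmxA dX mulmx0.
by move/matrixP/(_ (enum_rank e) 0); rewrite !mxE enum_rankK.
Qed.

Section MetricGraph.
Variables (R : realType) (G : mgraph R).
Implicit Types (p : gpoint G) (e : edge G) (h : edge G * bool).

Definition coord p h : R :=
  match val p with inl _ => if h.2 then len h.1 else 0 | inr (_, y) => y end.

Lemma stepE p h t : step p h t = edge_pt h.1 (coord p h + (-1) ^+ h.2 * t).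
Proof.
rewrite /step /coord; case: h => e [] /=; first by rewrite mulN1r.
by rewrite mul1r.
Qed.

Lemma val_edge_pt e x : 0 < x < len e -> val (edge_pt e x) = inr (e, x).
Proof.
move=> /[dup] x_in /andP[x0 _]; rewrite /edge_pt leNgt x0 /=.
by rewrite insubdK.
Qed.

Lemma edge_pt0 e : edge_pt e 0 = vpt (src e).
Proof. by rewrite /edge_pt lexx. Qed.

Lemma edge_pt_len e : edge_pt e (len e) = vpt (tgt e).
Proof.
by rewrite /edge_pt leNgt len_gt0 /= /insubd insubF //= ltxx andbF.
Qed.

Lemma edge_pt_coord p h : direction_at p h -> edge_pt h.1 (coord p h) = p.
Proof.
case: h p => e b [[v|[e' x]] px]; rewrite /direction_at /coord /=.
  move=> /eqP vE; apply: val_inj => /=; rewrite -vE /hend /=.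
  by case: b vE => _ /=; rewrite ?edge_pt0 ?edge_pt_len.
by move=> /eqP->; apply: val_inj; rewrite val_edge_pt.
Qed.

Lemma coord_itv p h : direction_at p h -> 0 <= coord p h <= len h.1.
Proof.
case: h p => e b [[v|[e' x]] px] ph; rewrite /coord /=.
  by case: b ph; rewrite lexx ltW ?len_gt0.
move/eqP: ph => /= ->; have /andP[x0 xl] : 0 < x < len e' by [].
by rewrite !ltW.
Qed.

Lemma near_step p h : direction_at p h ->
  \forall t \near (0 : R)^'+, 0 <= coord p h + (-1) ^+ h.2 * t <= len h.1.
Proof.
case: h p => e b [[v|[e' x]] /= px] ph; rewrite /coord /=.
- near=> t; have t0 : 0 < t by near: t; exact: nbhs_right_gt.
  have tl : t < len e by near: t; apply: nbhs_right_lt; exact: len_gt0.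
  by clear -t0 tl; case: b => /=; apply/andP; split; lra.
- have /andP[x0 xl] : 0 < x < len e' by [].
  move/eqP: ph => /= ->; near=> t.
  have t0 : 0 < t by near: t; exact: nbhs_right_gt.
  have tx : t < x by near: t; apply: nbhs_right_lt.
  have tl : t < len e' - x by near: t; apply: nbhs_right_lt; rewrite subr_gt0.
  by clear -t0 tx tl x0 xl; case: b => /=; apply/andP; split; lra.
Unshelve. all: by end_near. Qed.

Definition affine_on (f : gpoint G -> R) e (a : R) :=
  forall x, 0 <= x <= len e -> f (edge_pt e x) = f (edge_pt e 0) + a * x.

Lemma affine_on_step f a p h : direction_at p h -> affine_on f h.1 a ->
  \forall t \near (0 : R)^'+, f (step p h t) = f p + (-1) ^+ h.2 * a * t.
Proof.
move=> ph fa.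
have fp : f p = f (edge_pt h.1 0) + a * coord p h.
  by rewrite -fa ?edge_pt_coord // coord_itv.
near=> t; rewrite stepE fa ?fp; first by ring.
by near: t; exact: near_step.
Unshelve. all: by end_near. Qed.

Lemma outslope_near f p h s :
  (\forall t \near (0 : R)^'+, f (step p h t) = f p + s * t) -> outslope f p h = s.
Proof.
move=> fs; rewrite /outslope; apply: lim_near_cst => //.
near=> t; rewrite (near fs t) // addrAC subrr add0r mulfK //.
Unshelve. all: by end_near. Qed.

Lemma tangentT p h : tangent setT p h = direction_at p h.
Proof.
by rewrite /tangent (_ : `[< _ >] = true) ?andbT //; apply/asboolP; near=> t.
Unshelve. all: by end_near. Qed.


Lemma sum_tangent_interior (M : nmodType) e x (F : edge G * bool -> M) :
  0 < x < len e ->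
  \sum_(h | tangent setT (edge_pt e x) h) F h = F (e, false) + F (e, true).
Proof.
move=> xe; rewrite sum_halfedges (bigD1 e) //= big1 => [|e' ne'].
  by rewrite addr0 !tangentT /direction_at !val_edge_pt //= eqxx.
by rewrite !tangentT /direction_at !val_edge_pt //= (negbTE ne') addr0.
Qed.

Lemma valence_interior e x : 0 < x < len e -> valence setT (edge_pt e x) = 2%N.
Proof.
by move=> xe; rewrite /valence -sum1dep_card (@sum_tangent_interior nat).
Qed.

Lemma knot_lt (c : edge G -> seq R) e i j : subdivision c ->
  (i < j < (size (c e)).+2)%N -> knot c e i < knot c e j.
Proof.
move=> /(_ e) ce /andP[ij jn].
apply: (sorted_ltn_nth (@lt_trans _ R) 0 (s := 0 :: rcons (c e) (len e))) => //=;
  by rewrite inE size_rcons // (ltn_trans ij).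
Qed.

Lemma knot_size (c : edge G -> seq R) e : knot c e (size (c e)).+1 = len e.
Proof. by rewrite /knot /= nth_rcons ltnn eqxx. Qed.

Lemma PL_affine_on k f e : is_PL k f ->
  (forall x, 0 < x < len e -> pl_div setT f (edge_pt e x) = 0) ->
  exists a : int, affine_on f e (a%:~R / k%:R).
Proof.
move=> [c sd_c fPL] f_harm; set n := size (c e).
suff f_aff j : (j < n.+1)%N -> exists a : int, forall x,
    0 <= x <= knot c e j.+1 -> f (edge_pt e x) = f (edge_pt e 0) + a%:~R / k%:R * x.
  have [a fa] := f_aff n (ltnSn n); exists a => x; rewrite -(knot_size c e); exact: fa.
elim: j => [|j IHj] jn.
  by have [a fa] := fPL e (Ordinal jn); exists a => x /fa; rewrite /knot /= subr0.
have [a fa] := IHj (ltnW jn); have [b fb] := fPL e (Ordinal jn).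
move: fa fb => /=; set y := knot c e j.+1; set z := knot c e j.+2 => fa fb.
have y0 : 0 < y by apply: (@knot_lt c e 0 j.+1 sd_c); rewrite /= (ltn_trans jn).
have yz : y < z by apply: knot_lt; rewrite // ltnSn.
have yl : y < len e by rewrite -(knot_size c e); apply: knot_lt; rewrite // jn /=.
have ye : 0 < y < len e by rewrite y0.
clearbody y z.
have dir_y i : direction_at (edge_pt e y) (e, i).
  by rewrite /direction_at val_edge_pt //=.
have coord_y i : coord (edge_pt e y) (e, i) = y by rewrite /coord val_edge_pt.
have fbE : outslope f (edge_pt e y) (e, false) = b%:~R / k%:R.
  apply: outslope_near; near=> t; rewrite stepE coord_y mul1r (fb (y + t)); first by ring.
  apply/andP; split; first by rewrite lerDl ltW //; near: t; exact: nbhs_right_gt.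
  rewrite -lerBrDl ltW //; near: t; apply: nbhs_right_lt; by rewrite subr_gt0.
have fay : f (edge_pt e y) = f (edge_pt e 0) + a%:~R / k%:R * y.
  by rewrite fa // lexx ltW.
have faE : outslope f (edge_pt e y) (e, true) = - (a%:~R / k%:R).
  apply: outslope_near; near=> t.
  rewrite stepE coord_y mulN1r fay (fa (y - t)); first by ring.
  have t0 : 0 < t by near: t; exact: nbhs_right_gt.
  have ty : t < y by near: t; apply: nbhs_right_lt.
  by clear -t0 ty; apply/andP; split; lra.
have /eqP := f_harm _ ye.
rewrite /pl_div sum_tangent_interior // fbE faE subr_eq0 => /eqP ba.
exists a => x /andP[x0 xz]; have [xy|yx] := leP x y; first by apply: fa; rewrite x0.
rewrite fb ?xz ?(ltW yx) // fay ba; ring.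
Unshelve. all: by end_near. Qed.

End MetricGraph.

Lemma trop_surj (R : realType) (psi : admissible_cover R) (p : gpoint (GamT psi)) :
  exists q, trop psi q = p.
Proof.
have mapV_surj t : exists v, mapV v = t :> vert (GamT psi).
  have [v /eqP vt|no_v] := pickP (fun v => mapV v == t); first by exists v.
  by have := deg_fiber t; rewrite big_pred0.
case: p => [[t|[e' x]] px].
  by have [v <-] := mapV_surj t; exists (vpt v); apply: val_inj.
have [v ve] := mapV_surj (src e').
have := @Defs.harmonic _ psi v (e', false) (esym ve).
have [[e b] /= /andP[_ /eqP[eE _]] _|no_h] := pickP (fun h : edge (Gam psi) * bool =>
    (hend h == v) && ((mapE h.1, h.2) == (e', false))); last first.
  by rewrite big_pred0 // => deg0; have := deg_gt0 v; rewrite -deg0.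
case: _ / eE in px *.
have /andP[x0] : 0 < x < len (mapE e) by [].
have r0 : 0 < (ramif e)%:R :> R by case: (ramif12 e) => ->; rewrite ltr0n.
rewrite len_mapE => xl.
exists (edge_pt e (x / (ramif e)%:R)); apply: val_inj.
rewrite /trop val_edge_pt; last by rewrite divr_gt0 //= ltr_pdivrMr // mulrC.
by rewrite mulrC divfK ?gt_eqF // val_edge_pt.
Qed.

Section AdmissibleSlopes.
Variables (R : realType) (psi : admissible_cover R).
Local Notation GT := (GamT psi).
Implicit Types (f g : gpoint GT -> R) (v w t : vert GT).

Lemma admissible_affine_on v f : admissible_function v f ->
  exists a : edge GT -> int, forall e, affine_on f e ((a e)%:~R / 2).
Proof.
move=> [fPL f_div]; suff /choice[a fa] : forall e, exists a : int,
    affine_on f e (a%:~R / 2) by exists a.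
move=> e; apply: PL_affine_on fPL _ => x xe; have := f_div (edge_pt e x).
have deg0 : deg_branch (edge_pt e x) = 0%N.
  by apply: eq_card0 => i; rewrite !inE -val_eqE /= val_edge_pt.
rewrite /Dprime valence_interior // deg0 mulr0 addr0 subrr add0r => ->.
by rewrite -val_eqE /= val_edge_pt.
Qed.

Lemma admissible_slopes_even v w f g (a b : edge GT -> int) :
  admissible_function v f -> (forall e, affine_on f e ((a e)%:~R / 2)) ->
  admissible_function w g -> (forall e, affine_on g e ((b e)%:~R / 2)) ->
  forall e, exists m : int, a e - b e = m * 2.
Proof.
move=> [_ f_div] fa [_ g_div] gb e.
pose d e : int := a e - b e.
suff d0 : (d e)%:~R = 0 :> 'F_2.
  by apply/dvdzP; rewrite (dvdz_pcharf (pchar_Fp (isT : prime 2))) d0.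
apply: (@tree_cycle_eq0 GT 'F_2 (fun e => (d e)%:~R)).
- exact: GamT_connected.
- exact: GamT_genus.
move=> t; pose D : int := \sum_(h : edge GT * bool | hend h == t)
  (-1) ^+ h.2 * d h.1.
have D_even : D = 2 * ((vpt t == vpt v)%:R - (vpt t == vpt w)%:R).
  apply: (@intr_inj R); rewrite rmorphM rmorphB /= !rmorph_nat.
  rewrite -f_div -g_div opprD addrACA subrr add0r /pl_div -sumrB mulr_sumr.
  rewrite /D rmorph_sum /=.
  apply: eq_big => [h|h ht]; first by rewrite tangentT.
  have dir_h : direction_at (vpt t) h by [].
  rewrite (outslope_near (affine_on_step dir_h (fa h.1))).
  rewrite (outslope_near (affine_on_step dir_h (gb h.1))).
  by rewrite rmorphM rmorphB rmorphXn rmorphN1 /=; field.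
transitivity (D%:~R : 'F_2).
  rewrite /D rmorph_sum /=; apply: eq_bigr => h _.
  by rewrite rmorphM /=; case: h.2; rewrite ?mulN1r ?mul1r // rmorphN rmorph1 mulN1r.
by rewrite D_even rmorphM /= (_ : 2%:~R = 0 :> 'F_2) ?mul0r //; apply/eqP.
Qed.

End AdmissibleSlopes.

Lemma near0_linear_lt (R : realType) (k d : R) : 0 < d ->
  \forall t \near (0 : R)^'+, k * t < d.
Proof.
move=> d0; have [k0|k0] := leP k 0; near=> t.
  by apply: le_lt_trans d0; rewrite mulr_le0_ge0.
by rewrite mulrC -ltr_pdivlMr //; near: t; apply: nbhs_right_lt; rewrite divr_gt0.
Unshelve. all: by end_near. Qed.

Section DdivIntegral.
Variables (R : realType) (psi : admissible_cover R).
Local Notation GT := (GamT psi).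
Variables (lambar : vert GT -> gpoint GT -> R) (c : vert GT -> R).
Hypothesis lambar_adm : forall v, admissible_function v (lambar v).
Local Notation lamT := (lamT lambar c).

Lemma lamT_active p : 0 < lamT p -> exists v, lambar v p + c v = lamT p.
Proof.
move=> lamp; have [v /eqP vp|no_v] := pickP (fun v => lambar v p + c v == lamT p).
  by exists v.
suff : lamT p < lamT p by rewrite ltxx.
apply: bigmax_lt => // v _; rewrite lt_neqAle no_v /=.
exact: (le_bigmax 0 (fun v => lambar v p + c v)).
Qed.

(* The active function with the largest slope in direction [h] stays maximal. *)
Lemma lamT_step p h (s : vert GT -> R) : 0 < lamT p -> direction_at p h ->
  (forall v, \forall t \near (0 : R)^'+,
     lambar v (step p h t) = lambar v p + s v * t) ->
  exists2 v, lambar v p + c v = lamT p &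
    \forall t \near (0 : R)^'+, lamT (step p h t) = lamT p + s v * t.
Proof.
move=> lamp ph lambar_s; have [v0 /eqP v0p] := lamT_active lamp.
pose active := [pred v | lambar v p + c v == lamT p].
case: (@arg_maxP _ _ _ v0 active s v0p) => v /eqP vp s_max; exists v => //.
have lower w : lambar w p + c w <= lamT p.
  exact: (le_bigmax 0 (fun v => lambar v p + c v)).
have near_le w : \forall t \near (0 : R)^'+,
    lambar w (step p h t) + c w <= lamT p + s v * t.
  have [wp|wp] := eqVneq (lambar w p + c w) (lamT p).
    near=> t; rewrite (near (lambar_s w) t) // addrAC wp lerD2l.
    by rewrite ler_wpM2r //; apply: s_max; apply/eqP.
  have gap : 0 < lamT p - (lambar w p + c w) by rewrite subr_gt0 lt_neqAle wp lower.
  near=> t; rewrite (near (lambar_s w) t) //.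
  have : (s w - s v) * t < lamT p - (lambar w p + c w).
    by near: t; exact: near0_linear_lt.
  by move=> ?; lra.
have near_all : \forall t \near (0 : R)^'+, forall w,
    lambar w (step p h t) + c w <= lamT p + s v * t by exact: filter_forall.
near=> t; apply/le_anti/andP; split.
  apply: bigmax_le => [|w _]; last by move: w; near: t; exact: near_all.
  rewrite -lerBlDr sub0r -mulNr ltW //; near: t; exact: near0_linear_lt.
rewrite -vp addrAC -(near (lambar_s v) t) //.
exact: (le_bigmax 0 (fun v => lambar v (step p h t) + c v)).
Unshelve. all: by end_near. Qed.

Lemma Ddiv_int (A : set (gpoint GT)) p :
  [set q | 0 < lamT q] `<=` A -> 0 < lamT p ->
  exists m : int, Ddiv lambar c A p = m%:~R.
Proof.
move=> lamA lamp.
have [a lambar_a] := choice (fun v => admissible_affine_on (lambar_adm v)).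
pose s v (h : edge GT * bool) : R := (-1) ^+ h.2 * ((a v h.1)%:~R / 2).
have lambar_s h : direction_at p h -> forall v, \forall t \near (0 : R)^'+,
    lambar v (step p h t) = lambar v p + s v h * t.
  by move=> ph v; apply: affine_on_step.
have [v0 v0p] := lamT_active lamp.
have tangentA h : tangent A p h = direction_at p h.
  rewrite /tangent; case ph : (direction_at p h) => //=; apply/asboolP.
  have [v vp lam_s] := lamT_step lamp ph (lambar_s h ph).
  near=> t; apply: lamA => /=; rewrite (near lam_s t) //.
  rewrite -ltrBlDr sub0r -mulNr; near: t; exact: near0_linear_lt.
have valA : valence A p = valence setT p.
  by apply: eq_card => h; rewrite !inE tangentA tangentT.
have /choice[m mP] : forall h, exists m : int, direction_at p h ->
    outslope lamT p h = outslope (lambar v0) p h + m%:~R.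
  move=> h; case ph : (direction_at p h); last by exists 0.
  have [v vp lam_s] := lamT_step lamp ph (lambar_s h ph).
  have [m mE] := admissible_slopes_even (lambar_adm v) (lambar_a v)
    (lambar_adm v0) (lambar_a v0) h.1.
  exists ((-1) ^+ h.2 * m) => _.
  rewrite (outslope_near lam_s) (outslope_near (lambar_s h ph v0)) /s.
  have -> : a v h.1 = a v0 h.1 + m * 2 by rewrite -mE; ring.
  by rewrite !rmorphM rmorphD rmorphM rmorphXn rmorphN1 /=; field.
exists ((p == vpt v0)%:R + \sum_(h | direction_at p h) m h).
have [_ div_v0] := lambar_adm v0.
rewrite rmorphD rmorph_nat -div_v0 /Ddiv /Dprime valA -!addrA; do 3 congr (_ + _).
rewrite /pl_div rmorph_sum -(eq_bigl _ _ tangentA).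
rewrite (eq_bigl (tangent A p) _ (fun h => etrans (tangentT p h) (esym (tangentA h)))).
rewrite -big_split /=; apply: eq_bigr => h; rewrite tangentA; exact: mP.
Unshelve. all: by end_near. Qed.

End DdivIntegral.

Theorem lemma3p18 (R : realType) (psi : admissible_cover R)
    (lambar : vert (GamT psi) -> gpoint (GamT psi) -> R)
    (c : vert (GamT psi) -> R)
    (Hadm : forall v0, admissible_function v0 (lambar v0))
    (Hnorm : forall v0, normalized (lami lambar c v0))
    (Delta : set (gpoint (Gam psi)))
    (HDelta : minimal_genus_two_subcurve (genus psi)
                (graph_closure [set q | 0 < lam lambar c q]) Delta)
    (D1 D2 : gpoint (GamT psi))
    (HD1 : (trop psi @` Delta) D1)
    (HD2 : (trop psi @` Delta) D2)
    (HD12 : D1 <> D2)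
    (HD : forall p, (trop psi @` Delta) p ->
       Ddiv lambar c (trop psi @` Delta) p =
       2^-1 * ((p == D1)%:R + (p == D2)%:R)) :
  lamT lambar c D1 = 0 /\ lamT lambar c D2 = 0.
Proof.
have lamA : [set p | 0 < lamT lambar c p] `<=` trop psi @` Delta.
  move=> p /= lamp; have [q qp] := trop_surj p; exists q => //.
  by case: HDelta => _ + _; apply; left; rewrite /= lamE qp.
have lam0 p : (trop psi @` Delta) p ->
    Ddiv lambar c (trop psi @` Delta) p = 2^-1 -> lamT lambar c p = 0.
  move=> Ap Dp; apply/eqP; rewrite eq_le bigmax_ge_id andbT leNgt; apply/negP => lamp.
  have [m] := Ddiv_int Hadm lamA lamp; rewrite Dp => mE.
  have : (m * 2)%:~R = 1%:~R :> R by rewrite rmorphM /= -mE mulVf.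
  move/intr_inj => /(congr1 (fun z => (2 %| z)%Z)).
  by rewrite dvdz_mull.
split; apply: lam0 => //; rewrite HD // eqxx.
  by rewrite (negbTE (introN eqP HD12)) addr0 mulr1.
by rewrite eq_sym (negbTE (introN eqP HD12)) add0r mulr1.
Qed.
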